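(* Consider a rough differential equation $dy(t)=f(y(t))\,d\mathbf{X}(t)$ on $[0,T]$ in $\mathbb{R}^m$, and let $y_t^{s,y_0}$ denote its solution at time $t$ started in $y_0$ at time $s$. For a partition $t_0<t_1<\cdots<t_N=T$ of $[t_0,T]$ let a one-step method be given by $y_{n+1}=y_n+\Phi(y_n,\mathbf{X}_{t_n,t_{n+1}})$, started in $y_0=y(t_0)$, where $y(t)=y_t^{t_0,y_0}$. Let $r>0$. Suppose that there is a constant $C_1>0$ such that $$\big|y_t^{s,y_0}-y_0-\Phi(y_0,\mathbf{X}_{s,t})\big|\le C_1|t-s|^{1+r}$$ for $|t-s|$ sufficiently small, and a constant $C_2>0$ such that $$\big|y_t^{s,y_0}-y_t^{s,\tilde y_0}\big|\le C_2|y_0-\tilde y_0|,$$ for all $y_0,\tilde y_0\in\mathbb{R}^m$ and $0\le s\le t\le T$. Then there is some $C>0$ such that $$\max_{k=0,\ldots,N}|y(t_k)-y_k|\le C\,h^r$$ for all partitions with $h=\max_{k=0,\ldots,N-1}|t_{k+1}-t_k|$ sufficiently small.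
   Context: $\mathbf{X}$ is a rough path on $[0,T]$ and $\Phi$ is a given increment function with values in $\mathbb{R}^m$, depending on the current state and on the rough path increment over the step. Solutions of the equation are assumed to exist and be unique from every starting point, so that $y_s^{s,y_0}=y_0$ and $y_t^{s,y_0}=y_t^{u,\,y_u^{s,y_0}}$ for $s\le u\le t$. $|\cdot|$ is a norm on $\mathbb{R}^m$. *)

(* Defs.v *)
From HB Require Import structures.
From mathcomp Require Import all_boot all_order all_algebra.
From mathcomp Require Import all_classical all_reals all_analysis.

Set Implicit Arguments.
Unset Strict Implicit.
Unset Printing Implicit Defensive.

Import Order.TTheory GRing.Theory Num.Theory.
Import numFieldNormedType.Exports.

Local Open Scope classical_set_scope.
Local Open Scope ring_scope.

(* Branched rough paths are indexed by non-planar rooted forests with nodes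
   labelled by 1..d. They are encoded here by planar forests, on which
   everything is required to be invariant under [forest_iso]. *)
Inductive tree (d : nat) : Type := Node of 'I_d & seq (tree d).

HB.instance Definition _ (d : nat) := gen_eqMixin (tree d).
HB.instance Definition _ (d : nat) := gen_choiceMixin (tree d).

Notation forest d := (seq (tree d)).

Fixpoint degree d (t : tree d) : nat :=
  let: Node _ ts := t in (sumn (map (@degree d) ts)).+1.

Definition forest_degree d (f : forest d) : nat := sumn (map (@degree d) f).

Lemma finite_trees d N : finite_set [set tau : tree d | (degree tau <= N)%N].
Proof.
pose F k n :=
  [set f : forest d | (forest_degree f <= n)%N /\ (size f <= k)%N].
have degpos (t : tree d) : (0 < degree t)%N by case: t.
have szdeg (f : seq (tree d)) : (size f <= forest_degree f)%N.
  elim: f => //= t f IH; rewrite /forest_degree /= -add1n; exact: leq_add.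
elim: N => [|n IH].
  apply: (@sub_finite_set _ _ set0) => // -[i ts] /=; by rewrite ltn0.
have FF k : finite_set (F k n).
  elim: k => [|k IHk].
    apply: (@sub_finite_set _ _ [set [::]]) => //; last first.
    by move=> f [_]; rewrite leqn0 size_eq0 => /eqP.
  apply: (@sub_finite_set _ _ ([set [::]] `|`
      [set t :: f | t in [set tau : tree d | (degree tau <= n)%N]
                  & f in F k n])).
    move=> [|t f] [/= h1 h2]; [by left|right].
    rewrite /forest_degree /= in h1.
    exists t; first by rewrite /=; apply: leq_trans h1; exact: leq_addr.
    exists f => //; split => //; apply: leq_trans h1; exact: leq_addl.
  rewrite finite_setU; split => //; exact: finite_image2.
apply: (@sub_finite_set _ _ [set Node i ts | i in [set: 'I_d] & ts in F n n]).
  move=> [i ts] /= h; exists i => //; exists ts => //; split => //.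
  exact: leq_trans (szdeg ts) h.
apply: finite_image2 => //; exact: finite_finset.
Qed.

Inductive forest_iso d : forest d -> forest d -> Prop :=
| iso_nil : forest_iso [::] [::]
| iso_cons i f g f' g' : forest_iso f g -> forest_iso f' g' ->
    forest_iso (Node i f :: f') (Node i g :: g')
| iso_swap t u f : forest_iso (t :: u :: f) (u :: t :: f)
| iso_trans f g h : forest_iso f g -> forest_iso g h -> forest_iso f h.

(* The Connes-Kreimer coproduct as a list of its terms: (P, R) stands for the
   tensor product of the pruned part P with the trunk R, which contains the
   roots. It is given by Delta (B+_i f) = B+_i f (x) 1 + (id (x) B+_i) Delta f
   and multiplicativity. *)
Definition cuts_mul d (a b : seq (forest d * forest d)) :
    seq (forest d * forest d) :=
  [seq (x.1 ++ y.1, x.2 ++ y.2) | x <- a, y <- b].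

Definition cuts_prod d (s : seq (seq (forest d * forest d))) :
    seq (forest d * forest d) :=
  foldr (@cuts_mul d) [:: ([::], [::])] s.

Fixpoint tree_cuts d (t : tree d) : seq (forest d * forest d) :=
  let: Node i ts := t in
  ([:: t], [::]) ::
  [seq (c.1, [:: Node i c.2]) | c <- cuts_prod (map (@tree_cuts d) ts)].

Definition forest_cuts d (f : forest d) : seq (forest d * forest d) :=
  cuts_prod (map (@tree_cuts d) f).

Section RoughPaths.
Context {R : realType}.

Record is_control (T : R) (w : R -> R -> R) : Prop := IsControl {
  control_ge0 : forall s t, 0 <= s -> s <= t -> t <= T -> 0 <= w s t;
  control_diag : forall s, 0 <= s -> s <= T -> w s s = 0;
  control_superadd : forall s u t, 0 <= s -> s <= u -> u <= t -> t <= T ->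
    w s u + w u t <= w s t;
  control_continuous :
    {within [set st : R * R | 0 <= st.1 /\ st.1 <= st.2 /\ st.2 <= T],
      continuous (fun st => w st.1 st.2)} }.

(* [X s t f] is the coefficient <X_{s,t}, f>. It lives in the step-N truncated
   group, N = floor p, so coefficients of degree > N are set to 0: they carry
   no information. Taking w s t = t - s gives 1/p-Hoelder rough paths;
   (weakly) geometric p-rough paths are the special case of branched ones in
   which products of trees are in addition given by shuffles. *)
Record is_rough_path (d : nat) (p T : R) (w : R -> R -> R)
    (X : R -> R -> forest d -> R) : Prop := IsRoughPath {
  rp_unit : forall s t, 0 <= s -> s <= t -> t <= T -> X s t [::] = 1;
  rp_mul : forall s t f g, 0 <= s -> s <= t -> t <= T ->
    (forest_degree (f ++ g) <= Num.truncn p)%N ->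
    X s t (f ++ g) = X s t f * X s t g;
  rp_iso : forall s t f g, 0 <= s -> s <= t -> t <= T ->
    forest_iso f g -> X s t f = X s t g;
  rp_trunc : forall s t f, 0 <= s -> s <= t -> t <= T ->
    (Num.truncn p < forest_degree f)%N -> X s t f = 0;
  rp_chen : forall s u t f, 0 <= s -> s <= u -> u <= t -> t <= T ->
    (forest_degree f <= Num.truncn p)%N ->
    X s t f = \sum_(c <- forest_cuts f) X s u c.1 * X u t c.2;
  rp_var : exists2 K : R, 0 < K & forall s t tau,
    0 <= s -> s <= t -> t <= T -> (degree tau <= Num.truncn p)%N ->
    `|X s t [:: tau]| <= K * w s t `^ ((degree tau)%:R / p) }.

Variables (m d : nat).

Fixpoint is_Ck (k : nat) (g : 'cV[R]_m -> 'cV[R]_m) : Prop :=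
  continuous g /\
  (if k is k'.+1 then
     forall v, (forall y, derivable g y v) /\ is_Ck k' ('D_v g)
   else True).

(* iterated derivative D^k g(y)(v_1, ..., v_k), in fixed directions *)
Definition iter_derive (vs : seq 'cV[R]_m) (g : 'cV[R]_m -> 'cV[R]_m) :
    'cV[R]_m -> 'cV[R]_m :=
  foldr (fun v h => 'D_v h) g vs.

Fixpoint elem_diff (f : 'cV[R]_m -> 'M[R]_(m, d)) (t : tree d) :
    'cV[R]_m -> 'cV[R]_m :=
  let: Node i ts := t in fun y =>
  iter_derive (map (fun u => elem_diff f u y) ts) (fun z => col i (f z)) y.

(* Taylor weight prod_v 1/k_v!, k_v the number of children of the node v.
   Summed over the planar representatives of a non-planar tree tau, it gives
   1/sigma(tau), sigma(tau) being the symmetry factor. *)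
Fixpoint taylor_weight (t : tree d) : R :=
  let: Node _ ts := t in
  foldr *%R ((size ts)`!%:R^-1) (map taylor_weight ts).

(* sum_(1 <= |tau| <= N) f_tau(y) <x, tau> / sigma(tau), a finite sum
   by [finite_trees] *)
Definition bseries (N : nat) (f : 'cV[R]_m -> 'M[R]_(m, d)) (y : 'cV[R]_m)
    (x : forest d -> R) : 'cV[R]_m :=
  \sum_(tau \in [set tau : tree d | (degree tau <= N)%N])
    (taylor_weight tau * x [:: tau]) *: elem_diff f tau y.

(* y solves dy = f(y) dX on [s, T] with y(s) = y0 (Davie's sense); f is C^(N-1)
   so that the elementary differentials up to degree N exist. *)
Definition is_rde_solution (p T : R) (w : R -> R -> R)
    (X : R -> R -> forest d -> R) (f : 'cV[R]_m -> 'M[R]_(m, d))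
    (s : R) (y0 : 'cV[R]_m) (y : R -> 'cV[R]_m) : Prop :=
  [/\ forall i, is_Ck (Num.truncn p).-1 (fun z => col i (f z)),
      y s = y0,
      {within `[s, T], continuous y} &
      exists K theta : R, [/\ 0 < K, 1 < theta &
        forall u v, s <= u -> u <= v -> v <= T ->
        `|y v - y u - bseries (Num.truncn p) f (y u) (X u v)|
          <= K * w u v `^ theta]].

(* [y s y0] is the unique solution started in y0 at time s *)
Definition is_rde_flow (p T : R) (w : R -> R -> R)
    (X : R -> R -> forest d -> R) (f : 'cV[R]_m -> 'M[R]_(m, d))
    (y : R -> 'cV[R]_m -> R -> 'cV[R]_m) : Prop :=
  forall s y0, 0 <= s -> s <= T ->
    is_rde_solution p T w X f s y0 (y s y0) /\
    forall z, is_rde_solution p T w X f s y0 z ->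
      forall t, s <= t -> t <= T -> z t = y s y0 t.

Record is_norm (N : 'cV[R]_m -> R) : Prop := IsNorm {
  norm_eq0 : forall x, N x = 0 -> x = 0;
  norm_scale : forall a x, N (a *: x) = `|a| * N x;
  norm_triangle : forall x y, N (x + y) <= N x + N y }.

Fixpoint one_step (Phi : 'cV[R]_m -> (forest d -> R) -> 'cV[R]_m)
    (X : R -> R -> forest d -> R) (t : nat -> R) (y0 : 'cV[R]_m) (n : nat) :
    'cV[R]_m :=
  if n is n'.+1 then
    let y := one_step Phi X t y0 n' in y + Phi y (X (t n') (t n'.+1))
  else y0.

End RoughPaths.

(* The partition t0 < t_1 < ... < t_N is given by the list s of t_1, ..., t_N,
   and t_k is [grid t0 s k] for k <= N = size s. *)
Definition grid (R : realType) (t0 : R) (s : seq R) (k : nat) : R :=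
  nth t0 (t0 :: s) k.

Definition mesh (R : realType) (t0 : R) (s : seq R) : R :=
  \big[Num.max/0]_(k < size s) `|grid t0 s k.+1 - grid t0 s k|.

(* Main.v *)
Require Import Defs.
From HB Require Import structures.
From mathcomp Require Import all_boot all_order all_algebra.
From mathcomp Require Import all_classical all_reals all_analysis.

Set Implicit Arguments.
Unset Strict Implicit.
Unset Printing Implicit Defensive.

Import Order.TTheory GRing.Theory Num.Theory.
Import numFieldNormedType.Exports.

Local Open Scope classical_set_scope.
Local Open Scope ring_scope.

(** This is the classical local-to-global error argument, known as Lady
    Windermere's fan.  The exact solution started at [t_0] is compared with the
    exact solutions restarted from the successive numerical values
    [y_0, y_1, ..., y_j]: the first of them is the true solution, and for
    [j = k] the last one, observed at time [t_k], is [y_k] itself.  By the flow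
    property, two neighbouring curves of the fan, restarted from [y_n] at [t_n]
    and from [y_(n+1)] at [t_(n+1)], are two exact solutions that at time
    [t_(n+1)] differ by the local error of one step, which is at most
    [C1 (t_(n+1) - t_n)^(1+r)].  The Lipschitz bound transports this distance to
    [t_k] at the cost of a factor [C2], independent of the elapsed time, so the
    one-step errors merely add up ([one_step_global_error]):
      [|y(t_k) - y_k| <= C1 C2 sum_n (t_(n+1) - t_n)^(1+r)
                      <= C1 C2 h^r (t_k - t_0)].
    The flow property follows from uniqueness, because the restriction of a
    solution to a later starting time is again a solution
    ([rde_flow_cocycle]). *)

(** The continuity and the Davie expansion on [[s, T]] restrict to [[u, T]] with
    the same constants. *)
Lemma rde_solution_restrict (R : realType) (m d : nat) (p T : R)
    (w : R -> R -> R) (X : R -> R -> forest d -> R)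
    (f : 'cV[R]_m -> 'M[R]_(m, d)) (s u : R) (y0 : 'cV[R]_m)
    (z : R -> 'cV[R]_m) :
  s <= u -> is_rde_solution p T w X f s y0 z ->
  is_rde_solution p T w X f u (z u) z.
Proof.
move=> su [fC _ zcont [K [theta [K0 theta1 zexp]]]]; split => //.
  apply: continuous_subspaceW zcont => v /=; rewrite !in_itv /=.
  by move=> /andP[uv ->]; rewrite (le_trans su uv).
exists K, theta; split => // a b ua ab bT; apply: zexp => //.
exact: le_trans su ua.
Qed.

Lemma rde_flow_start (R : realType) (m d : nat) (p T : R)
    (w : R -> R -> R) (X : R -> R -> forest d -> R)
    (f : 'cV[R]_m -> 'M[R]_(m, d)) (y : R -> 'cV[R]_m -> R -> 'cV[R]_m)
    (s : R) (y0 : 'cV[R]_m) :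
  is_rde_flow p T w X f y -> 0 <= s -> s <= T -> y s y0 s = y0.
Proof. by move=> hy s0 sT; have [[]] := hy s y0 s0 sT. Qed.

Lemma rde_flow_cocycle (R : realType) (m d : nat) (p T : R)
    (w : R -> R -> R) (X : R -> R -> forest d -> R)
    (f : 'cV[R]_m -> 'M[R]_(m, d)) (y : R -> 'cV[R]_m -> R -> 'cV[R]_m)
    (s u t : R) (y0 : 'cV[R]_m) :
  is_rde_flow p T w X f y -> 0 <= s -> s <= u -> u <= t -> t <= T ->
  y s y0 t = y u (y s y0 u) t.
Proof.
move=> hy s0 su ut tT; have uT := le_trans ut tT.
have [sol _] := hy s y0 s0 (le_trans su uT).
have [_ uniq_sol] := hy u (y s y0 u) (le_trans s0 su) uT.
exact: uniq_sol (rde_solution_restrict su sol) t ut tT.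
Qed.

(** Here [L] bounds the local error per unit of time: the step from [t n] to
    [t n.+1] then costs at most [C2 * L * (t n.+1 - t n)] at time [t k], and
    these costs telescope.  The lemma is applied with [L = C1 h^r]. *)
Lemma one_step_global_error (R : realType) (m d : nat)
    (nrm : 'cV[R]_m -> R) (T L C2 : R) (X : R -> R -> forest d -> R)
    (y : R -> 'cV[R]_m -> R -> 'cV[R]_m)
    (Phi : 'cV[R]_m -> (forest d -> R) -> 'cV[R]_m)
    (t : nat -> R) (y0 : 'cV[R]_m) (k : nat) :
  is_norm nrm -> 0 <= C2 -> 0 <= t 0%N -> t k <= T ->
  (forall i j, (i <= j <= k)%N -> t i <= t j) ->
  (forall s z, 0 <= s -> s <= T -> y s z s = z) ->
  (forall s u v z, 0 <= s -> s <= u -> u <= v -> v <= T ->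
    y s z v = y u (y s z u) v) ->
  (forall z z' s v, 0 <= s -> s <= v -> v <= T ->
    nrm (y s z v - y s z' v) <= C2 * nrm (z - z')) ->
  (forall z n, (n < k)%N ->
    nrm (y (t n) z (t n.+1) - z - Phi z (X (t n) (t n.+1)))
      <= L * (t n.+1 - t n)) ->
  nrm (y (t 0%N) y0 (t k) - one_step Phi X t y0 k)
    <= C2 * L * (t k - t 0%N).
Proof.
move=> hnrm C20 t00 tkT tmono ystart ycoc ylip yloc.
have t0n n : (n <= k)%N -> 0 <= t n by move=> nk; apply: le_trans t00 (tmono _ _ _).
(* Walking down the fan: the [j]-th curve starts from [y_j] at time [t_j]. *)
suff fan j : (j <= k)%N ->
    nrm (y (t 0%N) y0 (t k) - y (t j) (one_step Phi X t y0 j) (t k))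
      <= C2 * L * (t j - t 0%N).
  by have := fan k (leqnn k); rewrite ystart // t0n.
elim: j => [_|j IH jk].
  rewrite /= !subrr mulr0.
  by have := norm_scale hnrm 0 0; rewrite scale0r normr0 mul0r => ->.
have jk' := ltnW jk.
set z := one_step Phi X t y0 j in IH *.
have tj : t j <= t j.+1 by apply: tmono; rewrite leqnSn.
have tSk : t j.+1 <= t k by apply: tmono; rewrite jk leqnn.
have -> : t j.+1 - t 0%N = (t j - t 0%N) + (t j.+1 - t j).
  by rewrite [RHS]addrC subrKA.
rewrite mulrDr -(subrKA (y (t j) z (t k))).
apply: le_trans (norm_triangle hnrm _ _) _; apply: lerD; first exact: IH.
rewrite (ycoc _ (t j.+1)) ?t0n //= -/z.
apply: le_trans (ylip _ _ _ _ (t0n _ jk) tSk tkT) _.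
by rewrite -mulrA ler_wpM2l // opprD addrA yloc.
Qed.

Lemma grid_le (R : realType) (a b : R) (ts : seq R) (i j : nat) :
  itv_partition a b ts -> (i <= j <= size ts)%N -> grid a ts i <= grid a ts j.
Proof.
move=> [ap _] /andP[]; rewrite leq_eqVlt => /predU1P[-> //|ij jk].
apply/ltW; apply: (sorted_ltn_nth lt_trans a (s := a :: ts) ap) => //.
by rewrite inE /= ltnS (leq_trans (ltnW ij)).
Qed.

Lemma grid_le_end (R : realType) (a b : R) (ts : seq R) (k : nat) :
  itv_partition a b ts -> (k <= size ts)%N -> grid a ts k <= b.
Proof.
move=> ab kts; rewrite /grid (set_nth_default b) //.
exact: itv_partition_nth_le ab.
Qed.

Lemma mesh_ge0 (R : realType) (a : R) (ts : seq R) : 0 <= mesh a ts.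
Proof. exact: bigmax_ge_id. Qed.

Lemma grid_step_le_mesh (R : realType) (a : R) (ts : seq R) (k : nat) :
  (k < size ts)%N -> `|grid a ts k.+1 - grid a ts k| <= mesh a ts.
Proof.
move=> kts; exact: (le_bigmax 0
  (fun i : 'I_(size ts) => `|grid a ts i.+1 - grid a ts i|) (Ordinal kts)).
Qed.

Theorem proposition1 (R : realType) (m d : nat) (nrm : 'cV[R]_m -> R)
  (hnrm : is_norm nrm)
  (T p : R) (hp : 1 <= p) (w : R -> R -> R) (hw : is_control T w)
  (X : R -> R -> forest d -> R) (hX : is_rough_path p T w X)
  (f : 'cV[R]_m -> 'M[R]_(m, d))
  (y : R -> 'cV[R]_m -> R -> 'cV[R]_m) (hy : is_rde_flow p T w X f y)
  (Phi : 'cV[R]_m -> (forest d -> R) -> 'cV[R]_m)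
  (r : R) (hr : 0 < r)
  (hloc : exists2 C1 : R, 0 < C1 & exists2 delta : R, 0 < delta &
    forall (y0 : 'cV[R]_m) (s t : R), 0 <= s -> s <= t -> t <= T ->
      `|t - s| <= delta ->
      nrm (y s y0 t - y0 - Phi y0 (X s t)) <= C1 * `|t - s| `^ (1 + r))
  (hlip : exists2 C2 : R, 0 < C2 &
    forall (y0 y0' : 'cV[R]_m) (s t : R), 0 <= s -> s <= t -> t <= T ->
      nrm (y s y0 t - y s y0' t) <= C2 * nrm (y0 - y0'))
  (t0 : R) (ht0 : 0 <= t0) (ht0T : t0 < T) (y0 : 'cV[R]_m) :
  exists2 C : R, 0 < C & exists2 h0 : R, 0 < h0 &
    forall ts : seq R, itv_partition t0 T ts -> mesh t0 ts <= h0 ->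
      \big[Num.max/0]_(k < (size ts).+1)
        nrm (y t0 y0 (grid t0 ts k) - one_step Phi X (grid t0 ts) y0 k)
      <= C * mesh t0 ts `^ r.
Proof.
have [C1 C10 [delta delta0 loc]] := hloc; have [C2 C20 lip] := hlip.
have T0 : 0 < T := le_lt_trans ht0 ht0T.
exists (C2 * C1 * T); first by rewrite !mulr_gt0.
exists delta => // ts part mesh_small.
have h0 := mesh_ge0 t0 ts; set h := mesh t0 ts in h0 mesh_small *.
have hr0 : 0 <= h `^ r := powR_ge0 h r.
apply: bigmax_le => [|[k /= kN] _].
  by rewrite mulr_ge0 // !mulr_ge0 // ltW.
rewrite ltnS in kN.
have gmono i j : (i <= j <= k)%N -> grid t0 ts i <= grid t0 ts j.
  by move=> /andP[ij jk]; apply: grid_le part _; rewrite ij (leq_trans jk).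
have gT i : (i <= k)%N -> grid t0 ts i <= T.
  by move=> ik; apply: grid_le_end part (leq_trans ik kN).
have g0 i : (i <= k)%N -> 0 <= grid t0 ts i.
  by move=> ik; apply: le_trans ht0 (gmono 0%N i _).
have step z n : (n < k)%N ->
    nrm (y (grid t0 ts n) z (grid t0 ts n.+1) - z
         - Phi z (X (grid t0 ts n) (grid t0 ts n.+1)))
      <= C1 * h `^ r * (grid t0 ts n.+1 - grid t0 ts n).
  move=> nk; have dth := grid_step_le_mesh t0 (leq_trans nk kN).
  have gn : grid t0 ts n <= grid t0 ts n.+1 by apply: gmono; rewrite leqnSn.
  apply: le_trans (loc z _ _ (g0 _ (ltnW nk)) gn (gT _ nk) _) _.
    exact: le_trans dth mesh_small.
  rewrite ger0_norm ?subr_ge0 // in dth *.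
  have r1 : (1 + r == 0) = false by rewrite gt_eqF ?addr_gt0.
  rewrite powRD ?r1 // powRr1 ?subr_ge0 // -mulrA.
  rewrite ler_wpM2l ?(ltW C10) // mulrC ler_wpM2r ?subr_ge0 //.
  by apply: ge0_ler_powR dth; rewrite ?nnegrE ?subr_ge0 // ltW.
apply: le_trans (one_step_global_error y0 hnrm (ltW C20) ht0 (gT _ (leqnn k))
  gmono _ _ lip step) _.
- by move=> s z s0 sT; apply: rde_flow_start hy s0 sT.
- by move=> s u v z; apply: rde_flow_cocycle hy.
have -> : C2 * C1 * T * h `^ r = C2 * (C1 * h `^ r) * T.
  by rewrite mulrAC !mulrA.
apply: ler_wpM2l; first by rewrite !mulr_ge0 // ltW.
by apply: le_trans (gT _ (leqnn k)); rewrite lerBlDr lerDl.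
Qed.
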